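(* For each $\psi\in\mathcal C(Y)$ there exists a unique constant $\tau_\psi\in\mathbb R$ such that the map $\bar p_\psi:B\to\mathbb R$ defined by $$\bar p_\psi(s):=\max_{y\in Y}\{q(s,y,\psi(y)+\tau_\psi)\}$$ is a probability density (with respect to $\mathcal L^{d-1}$ on $B$). Moreover, the set $$\mathcal S:=\{\bar p_\psi\mid\psi\in\mathcal C(Y)\}$$ is uniformly bounded and equicontinuous.
   Context: Let $d\ge 2$, let $B\subset\mathbb R^{d-1}$ be compact with non-empty interior, let $X:=B\times[0,+\infty)$ with points written $x=(s,p)$, and let $Y\subset\mathbb R^d$ be non-empty and compact. The cost $c:X\times Y\to[0,+\infty)$ satisfies: (A) $c$ is locally Lipschitz; (B) for all $s\in B$ and $y\in Y$ the function $c((s,\cdot),y):[0,+\infty)\to[0,+\infty)$ is strictly increasing and unbounded; (C) the set of functions $\{c((\cdot,p),y):B\to[0,+\infty)\mid p\in[0,+\infty),\,y\in Y\}$ is equicontinuous. $\mathcal C(Y)$ is the space of continuous real functions on $Y$ and $\mathcal L^{d-1}$ is Lebesgue measure on $\mathbb R^{d-1}$. Define $q:B\times Y\times\mathbb R\to[0,+\infty)$ by $q(s,y,\sigma):=c((s,\cdot),y)^{-1}(\sigma)$ if $\sigma\ge c((s,0),y)$, and $q(s,y,\sigma):=0$ otherwise. *)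

(* Defs.v *)
From HB Require Import structures.
From mathcomp Require Import all_boot all_order all_algebra.
From mathcomp Require Import all_classical all_reals all_analysis.

Set Implicit Arguments.
Unset Strict Implicit.
Unset Printing Implicit Defensive.
Import Order.TTheory GRing.Theory Num.Theory.
Import numFieldNormedType.Exports.
Local Open Scope classical_set_scope.
Local Open Scope ring_scope.

(* Row vectors carry the sigma-algebra generated by the coordinates, as
   n.-tuple does in the library; over R this is the Borel sigma-algebra. *)
Section measurable_rV.
Context {d : measure_display} {T : sigmaRingType d}.
Variable n : nat.

Let coord (i : 'I_n) (v : 'rV[T]_n) : T := v ord0 i.

Let rV_set0 : g_sigma_preimage coord set0.
Proof. exact: sigma_algebra0. Qed.

Let rV_setC A : g_sigma_preimage coord A -> g_sigma_preimage coord (~` A).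
Proof. exact: sigma_algebraC. Qed.

Let rV_bigcup (F : (set 'rV[T]_n)^nat) :
  (forall i, g_sigma_preimage coord (F i)) ->
  g_sigma_preimage coord (\bigcup_i (F i)).
Proof. exact: sigma_algebra_bigcup. Qed.

HB.instance Definition _ := @isMeasurable.Build (measure_tuple_display d)
  'rV[T]_n (g_sigma_preimage coord) rV_set0 rV_setC rV_bigcup.

Lemma measurable_coord (i : 'I_n) :
  measurable_fun [set: 'rV[T]_n] (fun v : 'rV[T]_n => v ord0 i).
Proof.
move=> _ Y mY; rewrite setTI; apply: sub_sigma_algebra => /=.
rewrite -bigcup_seq/=; exists i => /=; first by rewrite mem_index_enum.
by exists Y => //; rewrite setTI.
Qed.

Lemma measurable_fun_rV {d1 : measure_display} {T1 : measurableType d1}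
    (f : T1 -> 'rV[T]_n) :
  (forall i, measurable_fun [set: T1] (fun x => f x ord0 i)) ->
  measurable_fun [set: T1] f.
Proof.
move=> mf.
suff sub : g_sigma_preimage coord `<=` [set A | measurable (f @^-1` A)].
  by move=> _ A mA; rewrite setTI; exact: sub.
apply: smallest_sub.
  split=> /=; first by rewrite preimage_set0; exact: measurable0.
    by move=> A mA; rewrite setTD preimage_setC; exact: measurableC.
  by move=> F mF; rewrite preimage_bigcup; exact: bigcup_measurable.
rewrite -bigcup_seq; apply: bigcup_sub => i _ _ [A mA <-] /=.
by rewrite setTI; have := mf i measurableT A mA; rewrite setTI.
Qed.

End measurable_rV.

Section rV_lebesgue_measure.
Context {R : realType}.

Definition rV_cons (n : nat) (z : R * 'rV[R]_n) : 'rV[R]_n.+1 :=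
  @row_mx R 1 1 n z.1%:M z.2.

Definition rV_uncons (n : nat) (v : 'rV[R]_n.+1) : R * 'rV[R]_n :=
  (v ord0 ord0, @rsubmx R 1 1 n v).

Lemma rV_cons0 n (z : R * 'rV[R]_n) : rV_cons z ord0 ord0 = z.1.
Proof.
rewrite /rV_cons (_ : ord0 = lshift n (ord0 : 'I_1)); last exact: val_inj.
by rewrite (@row_mxEl _ 1 1 n) mxE eqxx.
Qed.

Lemma rV_consS n (z : R * 'rV[R]_n) (i : 'I_n) :
  rV_cons z ord0 (lift ord0 i) = z.2 ord0 i.
Proof.
rewrite /rV_cons (_ : lift ord0 i = rshift 1 i); last exact: val_inj.
by rewrite (@row_mxEr _ 1 1 n).
Qed.

Lemma rV_consK n : cancel (@rV_cons n) (@rV_uncons n).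
Proof. by move=> [x v]; rewrite /rV_uncons rV_cons0 /rV_cons row_mxKr. Qed.

Lemma measurable_rV_cons n : measurable_fun setT (@rV_cons n).
Proof.
apply: measurable_fun_rV => i; rewrite /rV_cons.
case: (@split_ordP 1 n i) => j ->.
- under eq_fun do rewrite /= (@row_mxEl _ 1 1 n) mxE [j]ord1 eqxx mulr1n.
  exact: measurable_fst.
- under eq_fun do rewrite /= (@row_mxEr _ 1 1 n).
  by apply: (measurableT_comp (measurable_coord j)); exact: measurable_snd.
Qed.

Lemma measurable_rV_uncons n : measurable_fun setT (@rV_uncons n).
Proof.
apply/measurable_fun_pair; first exact: measurable_coord.
apply: measurable_fun_rV => i.
under eq_fun do rewrite mxE.
exact: measurable_coord.
Qed.

Section step.
Variables (n : nat) (mu : {sigma_finite_measure set 'rV[R]_n -> \bar R}).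

Definition rV_lebesgue_step : set 'rV[R]_n.+1 -> \bar R :=
  pushforward (@lebesgue_measure R \x mu)%E (@rV_cons n).

Let step0 : rV_lebesgue_step set0 = 0%E.
Proof. by rewrite /rV_lebesgue_step /pushforward preimage_set0 measure0. Qed.

Let step_ge0 A : (0 <= rV_lebesgue_step A)%E.
Proof. by rewrite /rV_lebesgue_step /pushforward; exact: measure_ge0. Qed.

Let step_sigma_additive : semi_sigma_additive rV_lebesgue_step.
Proof.
have mc A : measurable A -> measurable (@rV_cons n @^-1` A).
  by move=> mA; rewrite -[X in measurable X]setTI; exact: measurable_rV_cons.
move=> F mF tF mUF; rewrite /rV_lebesgue_step /pushforward preimage_bigcup.
apply: measure_semi_sigma_additive.
- by move=> k; exact: mc.
- apply/trivIsetP => /= i j _ _ ij; rewrite -preimage_setI.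
  by move/trivIsetP : tF => /(_ _ _ _ _ ij) ->//; rewrite preimage_set0.
- by rewrite -preimage_bigcup; exact: mc.
Qed.

HB.instance Definition _ := isMeasure.Build _ _ _
  rV_lebesgue_step step0 step_ge0 step_sigma_additive.

Let step_sigma_finite : sigma_finite setT rV_lebesgue_step.
Proof.
have [F FT mF] : sigma_finite setT (@lebesgue_measure R \x mu)%E.
  have /sigma_finiteP[F [TF ndF Foo]] := sigma_finiteT (@lebesgue_measure R).
  have /sigma_finiteP[G [TG ndG Goo]] := sigma_finiteT mu.
  exists (fun k => F k `*` G k).
    rewrite -setXTT TF TG predeqE => -[x y]; split.
      move=> [/= [i _ Fix] [j _ Gjy]]; exists (maxn i j) => //; split.
      - by move: x Fix; exact/subsetPset/ndF/leq_maxl.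
      - by move: y Gjy; exact/subsetPset/ndG/leq_maxr.
    by move=> [i _ []/= ? ?]; split; exists i.
  move=> k; have [? ?] := Foo k; have [? ?] := Goo k.
  split; first exact: measurableX.
  by rewrite product_measure1E// lte_mul_pinfty// ge0_fin_numE.
exists (fun k => @rV_uncons n @^-1` F k).
  by rewrite -preimage_bigcup -FT preimage_setT.
move=> k; have [mFk Fkoo] := mF k; split.
  by rewrite -[X in measurable X]setTI; exact: measurable_rV_uncons.
rewrite /rV_lebesgue_step /pushforward -comp_preimage.
by rewrite (_ : _ \o _ = id) //; apply/funext => z; exact: rV_consK.
Qed.

HB.instance Definition _ := Measure_isSigmaFinite.Build _ _ _
  rV_lebesgue_step step_sigma_finite.

End step.

Fixpoint rV_lebesgue_measure (n : nat) :
    {sigma_finite_measure set 'rV[R]_n -> \bar R} :=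
  if n is m.+1 then rV_lebesgue_step (rV_lebesgue_measure m)
  else \d_(0 : 'rV[R]_0).

Lemma measurable_rV_box n (A : 'I_n -> set R) :
  (forall i, measurable (A i)) ->
  measurable [set v : 'rV[R]_n | forall i, A i (v ord0 i)].
Proof.
move=> mA; rewrite (_ : mkset _ =
  \big[setI/setT]_(i < n) ((fun v : 'rV[R]_n => v ord0 i) @^-1` A i)).
  apply: bigsetI_measurable => i _.
  by rewrite -[X in measurable X]setTI; exact: measurable_coord.
apply/seteqP; split=> v /=.
  by move=> vA; rewrite -bigcap_seq => i _; exact: vA.
by rewrite -bigcap_seq => vA i; apply: (vA i); rewrite /= mem_index_enum.
Qed.

Lemma rV_lebesgue_measure_box n (A : 'I_n -> set R) :
  (forall i, measurable (A i)) ->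
  rV_lebesgue_measure n [set v | forall i, A i (v ord0 i)] =
  (\prod_(i < n) lebesgue_measure (A i))%E.
Proof.
elim: n => [|n IHn] in A *; move=> mA.
  rewrite big_ord0 /= diracE mem_set//.
  by move=> [].
rewrite big_ord_recl -IHn//= /rV_lebesgue_step /pushforward.
rewrite -product_measure1E; [|exact: mA|]; last first.
  exact: (@measurable_rV_box n (fun i => A (lift ord0 i))).
congr product_measure1; apply/seteqP; split=> -[x v] /=.
  move=> xvA; split=> [|i]; first by have := xvA ord0; rewrite rV_cons0.
  by have := xvA (lift ord0 i); rewrite rV_consS.
move=> [xA vA] i; case: (unliftP ord0 i) => [j ->|->].
- by rewrite rV_consS; exact: vA.
- by rewrite rV_cons0.
Qed.

End rV_lebesgue_measure.

Section definitions.
Context {R : realType} {m n : nat}.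
Implicit Types (B : set 'rV[R]_m) (Y : set 'rV[R]_n).
Implicit Types (c : 'rV[R]_m * R -> 'rV[R]_n -> R) (psi : 'rV[R]_n -> R).

Definition prob_density B (f : 'rV[R]_m -> R) : Prop :=
  [/\ measurable_fun B f, (forall s, B s -> 0 <= f s) &
      (\int[rV_lebesgue_measure m]_(s in B) (f s)%:E = 1)%E].

(* The maximum of A: a junk value unless A has a greatest element. *)
Definition set_max (A : set R) : R := get (A `&` ubound A).

Definition q c (s : 'rV[R]_m) (y : 'rV[R]_n) (sigma : R) : R :=
  if c (s, 0) y <= sigma
  then 'pinv_(fun=> 0) `[0, +oo[ (fun p => c (s, p) y) sigma
  else 0.

Definition pbar c Y psi (tau : R) (s : 'rV[R]_m) : R :=
  set_max [set q c s y (psi y + tau) | y in Y].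

Definition tau_of c B Y psi : R :=
  get [set tau | prob_density B (pbar c Y psi tau)].

(* C(Y): a continuous function on Y is represented by any total function
   whose restriction to Y is continuous; pbar depends only on psi on Y. *)
Definition C_of Y : set ('rV[R]_n -> R) :=
  [set psi | {within Y, continuous psi}].

Definition S_of c B Y : set (subspace B -> R) :=
  [set pbar c Y psi (tau_of c B Y psi) | psi in C_of Y].

End definitions.

Arguments S_of {R m n} c B Y _.

(* Main.v *)
Require Import Defs.
From mathcomp Require Import all_boot all_order all_algebra.
From mathcomp Require Import all_classical all_reals all_analysis.
From mathcomp Require Import measurable_realfun lra.
Import Order.TTheory GRing.Theory Num.Theory.
Import numFieldNormedType.Exports.
Local Open Scope classical_set_scope.
Local Open Scope ring_scope.

Set Implicit Arguments.
Unset Strict Implicit.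
Unset Printing Implicit Defensive.

(** Everything rests on one equivalence: since p |-> c (s, p) y is a continuous
increasing bijection from [0, +oo[ onto [c (s, 0) y, +oo[, for P >= 0
  q s y sigma <= P   iff   sigma <= c (s, P) y               ([q_leE]),
hence, taking the maximum over y,
  pbar s <= P   iff   psi y + tau <= c (s, P) y for all y in Y  ([pbar_leP]).
Every question on the maximal inverse thus becomes one on c itself, and no
regularity of q has to be propagated through the maximum; only the existence of
that maximum uses the continuity of q in y ([q_max]).

Compactness of B and Y gives three facts about c: at a fixed level P it is
bounded above ([cost_bounded]), at a high enough level it exceeds any given M
everywhere ([cost_coercive]), and raising the level from p <= P to p + e
raises the cost by at least some eta > 0 that depends only on P and e
([cost_uniform_growth]). The last one inverts moduli of continuity: if passing
from (s, tau) to (s', tau') changes c (s, p) y - tau by at most eta for all p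
and y, then pbar, as long as it is at most P, increases by at most e
([pbar_shift]). Applied to s |-> s' with the equicontinuity of c it bounds the
oscillation of pbar in s, uniformly in psi and tau ([pbar_modulus]); applied to
tau |-> tau' it makes the integral of pbar over B continuous in tau.

That integral, the mass, vanishes for tau very negative, is at least 1 for tau
large because B has positive measure, and is strictly increasing where it is
positive, as pbar s is. The intermediate value theorem and strictness give the
unique normalizing constant ([unique_density]).

For the family of all densities, a density cannot exceed 2 / |B| at every point
of B. At a point s0 where it does not, the equivalence bounds psi + tau on Y by
max c (s0, 2 / |B|), a bound independent of psi and s0; coercivity turns it
into a bound on pbar at every point ([density_bounded]). With this common bound
as P, [pbar_modulus] is the equicontinuity of the family. *)

(** * Borel sets and Lebesgue measure of row vectors *)

Section rV_borel.
Context {R : realType} {n : nat}.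
Local Notation mu := (rV_lebesgue_measure (R := R) n).

Lemma rV_ballE (a : 'rV[R]_n) (r : R) :
  0 < r -> ball a r = [set v | forall i, ball (a ord0 i) r (v ord0 i)].
Proof.
move=> r0; apply/seteqP; split=> v.
  by case=> _ av i; exact: av.
by move=> av; split=> // i j; rewrite ord1; exact: av.
Qed.

Lemma measurable_rV_ball (a : 'rV[R]_n) (r : R) :
  0 < r -> measurable (ball a r).
Proof.
move=> r0; rewrite rV_ballE//.
apply: (measurable_rV_box (A := fun i => ball (a ord0 i) r)) => i.
exact: measurable_ball.
Qed.

(** An open set is the union of the countably many balls with rational centre
and radius 1 / (k + 1) that it contains, and a ball for the sup norm is
a box. *)
Lemma open_measurable_rV (U : set 'rV[R]_n) : open U -> measurable U.
Proof.
move=> oU.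
pose b (ak : 'rV[rat]_n * nat) : set 'rV[R]_n :=
  ball (map_mx (@ratr R) ak.1) ak.2.+1%:R^-1.
have -> : U = \bigcup_ak (if `[< b ak `<=` U >] then b ak else set0).
  apply/seteqP; split=> [x Ux|x [ak _]]; last first.
    by case: asboolP => // bU /bU.
  have /nbhs_ballP[e /= e0 xeU] : nbhs x U by exact: open_nbhs_nbhs.
  (* The rational ball found below has x within its radius of its centre, so it
     stays within twice that radius of x: hence e / 2. *)
  have [k ke] : exists k : nat, k.+1%:R^-1 < e / 2.
    have e20 : 0 < e / 2 by rewrite divr_gt0.
    by have [k _ /(_ k (leqnn k)) ?] := near_infty_natSinv_lt (PosNum e20); exists k.
  have k0 : 0 < k.+1%:R^-1 :> R by rewrite invr_gt0.
  have /choice[a aP] : forall i : 'I_n, exists r : rat,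
      ball (ratr r : R) k.+1%:R^-1 (x ord0 i).
    move=> i; have /(@rat_in_itvoo R)[r] : x ord0 i < x ord0 i + k.+1%:R^-1.
      by rewrite ltrDl.
    rewrite in_itv/= => /andP[xr rx]; exists r.
    by rewrite /ball/= ger0_norm ?subr_ge0 ?ltW// ltrBlDl.
  have bx : b (\row_i a i, k) x.
    by rewrite /b/= rV_ballE// => i /=; rewrite !mxE; exact: aP.
  exists (\row_i a i, k) => //; case: asboolP => // -[] y.
  move=> /(ball_triangle (ball_sym bx)) xy; apply: xeU; apply: le_ball xy.
  by rewrite [leRHS]splitr lerD// ltW.
apply: countable_bigcupT_measurable => // ak; case: ifPn => // _.
by apply: measurable_rV_ball; rewrite invr_gt0.
Qed.

Lemma compact_measurable_rV (A : set 'rV[R]_n) : compact A -> measurable A.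
Proof.
move=> /(compact_closed (@norm_hausdorff _ _)) cA.
rewrite -[A]setCK; apply: measurableC; apply: open_measurable_rV.
exact: closed_openC.
Qed.

Lemma within_continuous_measurable_rV (A : set 'rV[R]_n) (f : 'rV[R]_n -> R) :
  measurable A -> {within A, continuous f} -> measurable_fun A f.
Proof.
move=> mA /continuousP cf; apply: (measurability _ (RGenOpens.measurableE R)).
move=> _ [_ [a [b ->] <-]].
have /open_subspaceP[V oV VA] : open (f @^-1` `]a, b[ : set (subspace A)).
  by apply: cf; exact: interval_open.
rewrite setIC -VA; apply: measurableI => //; exact: open_measurable_rV.
Qed.

Lemma rV_lebesgue_measure_ball (a : 'rV[R]_n) (r : R) :
  0 < r -> mu (ball a r) = ((r *+ 2) ^+ n)%:E.
Proof.
move=> r0; rewrite rV_ballE//.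
rewrite (rV_lebesgue_measure_box (A := fun i => ball (a ord0 i) r)); last first.
  by move=> i; exact: measurable_ball.
under eq_bigr do rewrite lebesgue_measure_ball ?ltW//.
by rewrite prodEFin prodr_const card_ord.
Qed.

Lemma compact_rV_lebesgue_lty (A : set 'rV[R]_n) :
  compact A -> (mu A < +oo)%E.
Proof.
move=> cA; have [M [Mreal MA]] := compact_bounded cA.
have [r r0 Ar] : exists2 r, 0 < r & A `<=` ball 0 r.
  exists (`|M| + 2); first by rewrite ltr_wpDl.
  move=> x Ax; rewrite -ball_normE /= sub0r normrN.
  rewrite (@le_lt_trans _ _ (`|M| + 1))// ?ltrD2l ?ltr1n//.
  by apply: MA => //; rewrite (le_lt_trans (ler_norm M))// ltrDl.
rewrite (@le_lt_trans _ _ (mu (ball 0 r)))//.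
  by apply: le_measure; rewrite ?inE//;
    [exact: compact_measurable_rV|exact: measurable_rV_ball].
by rewrite rV_lebesgue_measure_ball// ltry.
Qed.

Lemma interior_rV_lebesgue_gt0 (A : set 'rV[R]_n) :
  measurable A -> A° !=set0 -> (0 < mu A)%E.
Proof.
move=> mA [a /nbhs_ballP[r /= r0 rA]].
rewrite (@lt_le_trans _ _ (mu (ball a r)))//.
  by rewrite rV_lebesgue_measure_ball// lte_fin exprn_gt0// mulrn_wgt0.
by apply: le_measure; rewrite ?inE//; exact: measurable_rV_ball.
Qed.

End rV_borel.

(** * Continuity on subspaces *)

(** The hypothesis speaks of neighbourhoods of pairs of points; at the diagonal
pair (x, x) it bounds the increments of f around x, in particular those from x. *)
Lemma locally_lipschitz_within_continuous {R : realType}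
    {V W : normedModType R} (A : set V) (f : V -> W) :
  [locally [lipschitz f x | x in A]] -> {within A, continuous f}.
Proof.
move=> fA; apply/subspace_continuousP => x Ax.
have /pinfty_ex_gt0[M M0 /nbhs_ballP[r /= r0 fM]] := fA (x, x) (conj Ax Ax).
apply/cvgrPdist_lt => e e0.
have d0 : 0 < Num.min r (e / M) by rewrite lt_min r0 divr_gt0.
have dr : Num.min r (e / M) <= r by rewrite ge_min lexx.
apply/nbhs_ballP; exists (Num.min r (e / M)) => //= z xz Az.
have := fM (x, z) (conj (ballxx x r0) (le_ball dr xz)) (conj Ax Az).
move=> /= /le_lt_trans; apply; rewrite -ltr_pdivlMl//.
move: xz; rewrite -ball_normE /= lt_min => /andP[_].
by rewrite mulrC.
Qed.

(** A point outside A is isolated in the subspace topology of A, whence the two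
cases. *)
Lemma near_subspace {T : topologicalType} (A : set T) (x : T) (Q : T -> Prop) :
  (A x -> \forall z \near x, A z -> Q z) -> (~ A x -> Q x) ->
  \forall z \near (x : subspace A), Q z.
Proof.
move=> inA outA; change (nbhs_subspace (A := A) x Q).
have [Ax|nAx] := pselect (A x).
  by rewrite -(nbhs_subspace_in Ax); exact: inA.
by rewrite -(nbhs_subspace_out nAx) => _ ->; exact: outA.
Qed.

Lemma within_continuous_comp_in {T U V : topologicalType} (A : set T)
    (D : set U) (g : T -> U) (f : U -> V) :
  continuous g -> (forall x, A x -> D (g x)) ->
  {within D, continuous f} -> {within A, continuous (f \o g)}.
Proof.
move=> cg gAD /subspace_continuousP cf; apply/subspace_continuousP => x Ax.
apply: cvg_comp (cf _ (gAD _ Ax)) => P /(cg x).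
move=> gP; apply: (@filterS _ (nbhs x) _ _ _ _ gP) => z DP Az.
by apply: DP; exact: gAD.
Qed.

Lemma continuous_pair {T U V : topologicalType} (f : T -> U) (g : T -> V) :
  continuous f -> continuous g -> continuous (fun x => (f x, g x)).
Proof. by move=> cf cg x; exact: (cvg_pair (cf x) (cg x)). Qed.

Lemma continuous_fst_fst {T U V : topologicalType} :
  continuous (fun z : T * U * V => z.1.1).
Proof. by move=> z; apply: cvg_comp; [exact: cvg_fst|exact: cvg_fst]. Qed.

Lemma continuous_snd_fst {T U V : topologicalType} :
  continuous (fun z : T * U * V => z.1.2).
Proof. by move=> z; apply: cvg_comp; [exact: cvg_fst|exact: cvg_snd]. Qed.

Lemma within_continuous_near {R : realType} {T : topologicalType} (A : set T)
    (f : T -> R) (x : T) (e : R) :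
  {within A, continuous f} -> A x -> 0 < e ->
  \forall z \near x, A z -> `|f x - f z| < e.
Proof.
by move=> /subspace_continuousP /(_ x) cf /cf /cvgrPdist_lt; apply.
Qed.

Lemma within_continuous_near_gt0 {R : realType} {T : topologicalType}
    (A : set T) (f : T -> R) (x : T) :
  {within A, continuous f} -> A x -> 0 < f x ->
  \forall z \near x, A z -> 0 < f z.
Proof.
move=> cf Ax fx0; apply: filterS (within_continuous_near cf Ax fx0) => z fz Az.
by have := le_lt_trans (ler_norm _) (fz Az); rewrite gtrBl.
Qed.

Lemma compact_gt0_bound {R : realType} {T : topologicalType} (A : set T)
    (f : T -> R) :
  compact A -> {within A, continuous f} -> (forall x, A x -> 0 < f x) ->
  exists2 e, 0 < e & forall x, A x -> e <= f x.
Proof.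
move=> cA cf f0; have [->|/set0P A0] := eqVneq A set0; first by exists 1.
have [x /set_mem Ax xmin] := compact_EVT_min A0 cA cf.
by exists (f x) => [|z Az]; [exact: f0|exact/xmin/mem_set].
Qed.

Lemma compact_upper_bound {R : realType} {T : topologicalType} (A : set T)
    (f : T -> R) :
  compact A -> {within A, continuous f} ->
  exists M, forall x, A x -> f x <= M.
Proof.
move=> cA cf; have [->|/set0P A0] := eqVneq A set0; first by exists 0.
have [x /set_mem Ax xmax] := compact_EVT_max A0 cA cf.
by exists (f x) => z Az; exact/xmax/mem_set.
Qed.

(** * The cost and its partial inverse *)

Section cost.
Context {R : realType} {m n : nat}.
Variables (B : set 'rV[R]_m) (Y : set 'rV[R]_n).
Variable c : 'rV[R]_m * R -> 'rV[R]_n -> R.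
Hypothesis Y_neq0 : Y !=set0.
Hypothesis B_compact : compact B.
Hypothesis Y_compact : compact Y.
Hypothesis c_cont :
  {within (B `*` `[0, +oo[) `*` Y, continuous (fun z => c z.1 z.2)}.
Hypothesis c_incr : forall s y, B s -> Y y ->
  {in `[0, +oo[ &, {homo (fun p => c (s, p) y) : p p' / p < p'}}.
Hypothesis c_unbounded : forall s y, B s -> Y y ->
  ~ [bounded c (s, p) y | p in `[0, +oo[%classic].
Hypothesis c_equi : equicontinuous (`[0, +oo[ `*` Y)
  (fun (py : R * 'rV[R]_n) (s : subspace B) => c (s, py.1) py.2).

Lemma cost_leE s y p p' : B s -> Y y -> 0 <= p -> 0 <= p' ->
  (c (s, p) y <= c (s, p') y) = (p <= p').
Proof.
move=> Bs Yy p0 p'0; apply: (le_mono_in (c_incr Bs Yy)).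
- by rewrite in_itv/= p0.
- by rewrite in_itv/= p'0.
Qed.

Lemma cost_ltE s y p p' : B s -> Y y -> 0 <= p -> 0 <= p' ->
  (c (s, p) y < c (s, p') y) = (p < p').
Proof. by move=> Bs Yy p0 p'0; rewrite !ltNge cost_leE. Qed.

(** The section p |-> c (s, p) y is bounded below by its value at 0, so only its
upper bounds can fail to exist. *)
Lemma cost_unbounded s y (M : R) : B s -> Y y ->
  exists2 p, 0 <= p & M < c (s, p) y.
Proof.
move=> Bs Yy; apply: contrapT => nM; apply: (c_unbounded Bs Yy).
have cM p : 0 <= p -> c (s, p) y <= M.
  by move=> p0; rewrite leNgt; apply/negP => Mp; apply: nM; exists p.
exists (Num.max M (- c (s, 0) y)); split; first exact: num_real.
move=> K /ltW MK p /=; rewrite in_itv/= andbT => p0; apply: le_trans MK.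
rewrite ler_norml lerNl le_max lerN2.
by rewrite cost_leE// p0 orbT/= le_max cM.
Qed.

Lemma cost_section_continuous s y : B s -> Y y ->
  {within `[0, +oo[, continuous (fun p => c (s, p) y)}.
Proof.
move=> Bs Yy.
apply: (within_continuous_comp_in (g := fun p : R => ((s, p), y)) _ _ c_cont) => //.
apply: continuous_pair; last by move=> p; exact: cvg_cst.
by apply: continuous_pair => p; [exact: cvg_cst|exact: cvg_id].
Qed.

Lemma cost_surj s y sigma : B s -> Y y -> c (s, 0) y <= sigma ->
  exists2 p, 0 <= p & c (s, p) y = sigma.
Proof.
move=> Bs Yy c0; have [p1 p10 /ltW cp1] := cost_unbounded sigma Bs Yy.
have [||p] := @IVT R (fun p => c (s, p) y) 0 p1 sigma p10.
- apply: continuous_subspaceW (cost_section_continuous Bs Yy) => p /=.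
  by rewrite !in_itv/= => /andP[->].
- by rewrite ge_min c0 le_max cp1 orbT.
- by rewrite in_itv/= => /andP[p0 _] <-; exists p.
Qed.

Lemma q_eq s y p : B s -> Y y -> 0 <= p -> q c s y (c (s, p) y) = p.
Proof.
move=> Bs Yy p0; rewrite /q cost_leE// p0.
rewrite (@pinvKV _ _ _ _ (fun p => c (s, p) y))//; last first.
  by rewrite inE/= in_itv/= p0.
move=> a b; rewrite !inE/= !in_itv/= !andbT => a0 b0 /eqP ab.
by apply/eqP; move: ab; rewrite !eq_le !cost_leE.
Qed.

(** The equivalence that turns the inverse q into the cost. It also covers the
convention q = 0 below c (s, 0) y, where both sides hold for every P >= 0. *)
Lemma q_leE s y sigma P : B s -> Y y -> 0 <= P ->
  (q c s y sigma <= P) = (sigma <= c (s, P) y).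
Proof.
move=> Bs Yy P0; have [c0|c0] := leP (c (s, 0) y) sigma.
  by have [p p0 <-] := cost_surj Bs Yy c0; rewrite q_eq// cost_leE.
rewrite /q (lt_geF c0) P0; apply/esym.
by rewrite (le_trans (ltW c0))// cost_leE.
Qed.

Lemma q_ge0 s y sigma : B s -> Y y -> 0 <= q c s y sigma.
Proof.
move=> Bs Yy; have [c0|c0] := leP (c (s, 0) y) sigma.
  by have [p p0 <-] := cost_surj Bs Yy c0; rewrite q_eq.
by rewrite /q (lt_geF c0).
Qed.

(** Both translates by e and by 0 are needed on a product set that is bounded
in p, so that compactness applies to it. *)
Lemma cost_shift_continuous (P e : R) : 0 <= e ->
  {within (B `*` `[0, P]) `*` Y,
    continuous (fun z => c (z.1.1, z.1.2 + e) z.2)}.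
Proof.
move=> e0.
apply: (within_continuous_comp_in
  (g := fun z : _ * _ => ((z.1.1, z.1.2 + e), z.2)) _ _ c_cont) => /=.
  apply: continuous_pair; last by move=> z; exact: cvg_snd.
  apply: continuous_pair; first exact: continuous_fst_fst.
  by move=> z; apply: cvgD; [exact: continuous_snd_fst|exact: cvg_cst].
move=> [[s p] y] /= [[Bs]]; rewrite !in_itv/= => /andP[p0 _] Yy.
by rewrite andbT addr_ge0.
Qed.

(** A continuous positive function, here (s, p, y) |-> c (s, p + e) y - c (s, p) y,
is bounded away from 0 on the compact set B x [0, P] x Y. *)
Lemma cost_uniform_growth (P e : R) : 0 < e ->
  exists2 eta, 0 < eta & forall s y p, B s -> Y y -> 0 <= p <= P ->
    c (s, p) y + eta <= c (s, p + e) y.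
Proof.
move=> e0.
have [||[[s p] y] /= [[Bs]]|] := @compact_gt0_bound R _ ((B `*` `[0, P]) `*` Y)
    (fun z => c (z.1.1, z.1.2 + e) z.2 - c (z.1.1, z.1.2 + 0) z.2).
- apply: compact_setX => //; apply: compact_setX => //.
  exact: segment_compact.
- by apply: within_continuousB; apply: cost_shift_continuous => //; exact: ltW.
- rewrite in_itv/= => /andP[p0 _] Yy.
  by rewrite subr_gt0 addr0 cost_ltE ?ltrDl// addr_ge0// ltW.
- move=> eta eta0 etaP; exists eta => // s y p Bs Yy pP.
  have /= := etaP (s, p, y); rewrite lerBrDl addr0; apply.
  by split => //; split => //=; rewrite in_itv.
Qed.

Lemma cost_bounded (P : R) : 0 <= P ->
  exists M, forall s y, B s -> Y y -> c (s, P) y <= M.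
Proof.
move=> P0; have [||M MP] := @compact_upper_bound R _ ((B `*` `[0, P]) `*` Y)
    (fun z => c (z.1.1, z.1.2 + 0) z.2).
- apply: compact_setX => //; apply: compact_setX => //.
  exact: segment_compact.
- exact: cost_shift_continuous.
- exists M => s y Bs Yy; have /= := MP (s, P, y); rewrite addr0; apply.
  by split => //; split => //=; rewrite in_itv/= P0 lexx.
Qed.

Lemma cost_slice_continuous (p : R) : 0 <= p ->
  {within B `*` Y, continuous (fun z => c (z.1, p) z.2)}.
Proof.
move=> p0; apply: (within_continuous_comp_in
  (g := fun z : _ * _ => ((z.1, p), z.2)) _ _ c_cont) => /=.
  apply: continuous_pair; last by move=> z; exact: cvg_snd.
  by apply: continuous_pair => z; [exact: cvg_fst|exact: cvg_cst].
by move=> z [/= Bz Yz]; rewrite in_itv/= p0.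
Qed.

(** Each (s, y) has a level at which the cost exceeds M, this level works in a
neighbourhood of (s, y) and every higher level works too by monotonicity;
compactness of B x Y makes it uniform. *)
Lemma cost_coercive (M : R) :
  exists2 P, 0 <= P & forall s y, B s -> Y y -> M <= c (s, P) y.
Proof.
have [P P0 MP] : exists2 P, 0 < P & B `*` Y `<=` [set z | M <= c (z.1, P) z.2].
  apply: pinfty_ex_gt0.
  have /compact_near_coveringP/near_covering_withinP :=
    compact_setX B_compact Y_compact.
  apply=> -[s y] [/= Bs Yy]; have [p p0 Mp] := cost_unbounded M Bs Yy.
  (* The excess over M at (s, y) is the tolerance for the nearby values. *)
  have gap : 0 < c (s, p) y - M by rewrite subr_gt0.
  have BYsy : (B `*` Y) (s, y) by [].
  have near_s := within_continuous_near (cost_slice_continuous p0) BYsy gap.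
  near=> z p' => -[Bz Yz].
  have pp' : p <= p' by near: p'; apply: nbhs_pinfty_ge; rewrite num_real.
  rewrite (@le_trans _ _ (c (z.1, p) z.2))// ?cost_leE ?(le_trans p0)//.
  have /(_ (conj Bz Yz)) : (B `*` Y) z ->
      `|c (s, p) y - c (z.1, p) z.2| < c (s, p) y - M.
    by near: z; exact: near_s.
  by move=> /(le_lt_trans (ler_norm _)); rewrite ltrD2l ltrN2 => /ltW.
exists P; first exact: ltW.
by move=> s y Bs Yy; exact: (MP (s, y)).
Unshelve. all: by end_near. Qed.

(** * The maximal inverse *)

Lemma cost_continuous_in_target s p : B s -> 0 <= p ->
  {within Y, continuous (fun y => c (s, p) y)}.
Proof.
move=> Bs p0; apply: (within_continuous_comp_in
  (g := fun y : 'rV[R]_n => ((s, p), y)) _ _ c_cont) => /=.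
  by apply: continuous_pair => y; [exact: cst_continuous|exact: cvg_id].
by move=> y Yy; rewrite in_itv/= p0.
Qed.

Lemma C_of_addr psi tau : C_of Y psi ->
  {within Y, continuous (fun y => psi y + tau)}.
Proof.
move=> cpsi; apply: within_continuousD => //.
by apply: continuous_subspaceT; exact: cst_continuous.
Qed.

(** The value p at y is characterized by psi y + tau <= c (s, p + e) y and, when
p - e >= 0, by psi y + tau > c (s, p - e) y; both inequalities are strict for
e > 0 and therefore persist near y. *)
Lemma q_continuous s psi tau : B s -> C_of Y psi ->
  {within Y, continuous (fun y => q c s y (psi y + tau))}.
Proof.
move=> Bs cpsi; apply/subspace_continuousP => y Yy.
apply/cvgrPdist_le => e e0; rewrite /from_subspace/=.
set p := q c s y _.
have p0 : 0 <= p by exact: q_ge0.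
have pe0 : 0 <= p + e by rewrite addr_ge0// ltW.
have upper : \forall z \near y, Y z -> 0 < c (s, p + e) z - (psi z + tau).
  apply: within_continuous_near_gt0 => //.
    apply: within_continuousB; last exact: C_of_addr.
    exact: cost_continuous_in_target.
  rewrite subr_gt0 (@le_lt_trans _ _ (c (s, p) y))//; first by rewrite -q_leE.
  by rewrite cost_ltE// ltrDl.
have lower : \forall z \near y, Y z -> p - e <= q c s z (psi z + tau).
  have [pe|pe] := ltP (p - e) 0.
    by near=> z => Yz; rewrite (le_trans (ltW pe))// q_ge0.
  have : \forall z \near y, Y z -> 0 < psi z + tau - c (s, p - e) z.
    apply: within_continuous_near_gt0 => //.
      apply: within_continuousB; first exact: C_of_addr.
      exact: cost_continuous_in_target.
    by rewrite subr_gt0 ltNge -q_leE// -ltNge gtrBl.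
  apply: filterS => z hz Yz; move/(_ Yz) : hz.
  by rewrite subr_gt0 ltNge -q_leE// -ltNge => /ltW.
apply: filterS2 upper lower => z up lo Yz.
have := lo Yz; have := up Yz; rewrite subr_gt0 => /ltW; rewrite -q_leE//.
by move=> u l; rewrite ler_norml; apply/andP; split; lra.
Unshelve. all: by end_near. Qed.

Lemma q_max s psi tau : B s -> C_of Y psi ->
  exists2 y, Y y & forall y', Y y' ->
    q c s y' (psi y' + tau) <= q c s y (psi y + tau).
Proof.
move=> Bs cpsi.
have [y /set_mem Yy ymax] :=
  EVT_max_rV Y_neq0 Y_compact (q_continuous (tau := tau) Bs cpsi).
by exists y => // z /mem_set; exact: ymax.
Qed.

(** A greatest element exists, so [set_max] is not its default value. *)
Lemma pbar_eq s psi tau : B s -> C_of Y psi ->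
  exists2 y, Y y & pbar c Y psi tau s = q c s y (psi y + tau) /\
    forall y', Y y' -> q c s y' (psi y' + tau) <= pbar c Y psi tau s.
Proof.
move=> Bs cpsi; have [y Yy ymax] := q_max tau Bs cpsi.
pose A := [set q c s y (psi y + tau) | y in Y].
have /getPex[[z Yz zE] zub] : exists x, (A `&` ubound A) x.
  exists (q c s y (psi y + tau)); split; first by exists y.
  by move=> _ [z Yz <-]; exact: ymax.
exists z => //; split => [|y' Yy']; first by rewrite zE.
by apply: zub; exists y'.
Qed.

Lemma pbar_ge0 s psi tau : B s -> C_of Y psi -> 0 <= pbar c Y psi tau s.
Proof. by move=> Bs /(pbar_eq tau Bs)[y Yy [-> _]]; exact: q_ge0. Qed.

Lemma pbar_leP s psi tau P : B s -> C_of Y psi -> 0 <= P ->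
  pbar c Y psi tau s <= P <-> forall y, Y y -> psi y + tau <= c (s, P) y.
Proof.
move=> Bs cpsi P0; have [y Yy [yE ymax]] := pbar_eq tau Bs cpsi.
split=> [sP z Yz|cP]; first by rewrite -q_leE// (le_trans (ymax _ Yz)).
by rewrite yE q_leE// cP.
Qed.

(** With p the value of pbar at (s, tau), one has
psi y + tau' <= c (s', p) y + eta <= c (s', p + e) y for every y. Taking s = s'
or tau = tau' gives the two moduli of continuity of pbar. *)
Lemma pbar_shift (P e eta : R) s s' psi tau tau' : 0 < e ->
  (forall s y p, B s -> Y y -> 0 <= p <= P ->
    c (s, p) y + eta <= c (s, p + e) y) ->
  B s -> B s' -> C_of Y psi -> pbar c Y psi tau s <= P ->
  (forall p y, 0 <= p -> Y y -> c (s, p) y + tau' <= c (s', p) y + tau + eta) ->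
  pbar c Y psi tau' s' <= pbar c Y psi tau s + e.
Proof.
move=> e0 growth Bs Bs' cpsi sP close.
have p0 := pbar_ge0 tau Bs cpsi.
apply/pbar_leP => //; first by rewrite addr_ge0// ltW.
move=> y Yy.
have := (pbar_leP tau Bs cpsi p0).1 (lexx _) y Yy.
have := growth s' y (pbar c Y psi tau s) Bs' Yy; rewrite p0 sP => /(_ isT).
have := close _ y p0 Yy.
by move=> a1 a2 a3; lra.
Qed.

(** The neighbourhood depends on P and e only through the growth constant eta,
hence not on psi or tau: this is equicontinuity, for functions bounded by P. *)
Lemma pbar_modulus (P e : R) s : 0 < e -> B s ->
  \forall s' \near s, B s' -> forall psi tau, C_of Y psi ->
    (forall s, B s -> pbar c Y psi tau s <= P) ->
    `|pbar c Y psi tau s - pbar c Y psi tau s'| <= e.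
Proof.
move=> e0 Bs; have [eta eta0 growth] := cost_uniform_growth P e0.
have /(nbhs_subspace_ex _ Bs)[V Vs VB] :=
  c_equi s (entourage_ball R (PosNum eta0)).
apply: filterS Vs => s' Vs' Bs' psi tau cpsi psiP.
have : (V `&` B) s' by []; rewrite -VB => -[/= close _].
have close' p y : 0 <= p -> Y y -> `|c (s, p) y - c (s', p) y| < eta.
  move=> p0 Yy; have := close (p, y); rewrite -ball_normE/=; apply.
  by rewrite in_itv/= p0.
have : pbar c Y psi tau s <= pbar c Y psi tau s' + e.
  apply: (pbar_shift e0 growth) => // [|p y p0 Yy]; first exact: psiP.
  by have := close' p y p0 Yy; rewrite ltr_norml => /andP[? ?]; lra.
have : pbar c Y psi tau s' <= pbar c Y psi tau s + e.
  apply: (pbar_shift e0 growth) => // [|p y p0 Yy]; first exact: psiP.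
  by have := close' p y p0 Yy; rewrite ltr_norml => /andP[? ?]; lra.
by move=> u l; rewrite ler_norml; apply/andP; split; lra.
Qed.

Lemma pbar_bounded psi tau : C_of Y psi ->
  exists P, forall tau' s, tau' <= tau -> B s -> pbar c Y psi tau' s <= P.
Proof.
move=> cpsi; have [M psiM] := compact_upper_bound Y_compact cpsi.
have [P P0 MP] := cost_coercive (M + tau).
exists P => tau' s tau't Bs; apply/pbar_leP => // y Yy.
by rewrite (le_trans _ (MP s y Bs Yy))// lerD// psiM.
Qed.

Lemma pbar_continuous psi tau : C_of Y psi ->
  {within B, continuous (pbar c Y psi tau)}.
Proof.
move=> cpsi; have [P psiP] := pbar_bounded tau cpsi.
apply/subspace_continuousP => s Bs; apply/cvgrPdist_le => e e0.
apply: filterS (pbar_modulus P e0 Bs) => s' close Bs'.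
by apply: close => // s'' Bs''; exact: psiP.
Qed.

(** * The mass of the maximal inverse *)

Hypothesis c_ge0 : forall s (p : R) y, B s -> 0 <= p -> Y y -> 0 <= c (s, p) y.
Hypothesis B_int : B° !=set0.

Local Notation mu := (rV_lebesgue_measure (R := R) m).

Let mB : measurable B. Proof. exact: compact_measurable_rV. Qed.

Let muB_gt0 : 0 < fine (mu B).
Proof.
by rewrite fine_gt0// interior_rV_lebesgue_gt0// compact_rV_lebesgue_lty.
Qed.

Lemma integrable_pbar psi tau : C_of Y psi ->
  mu.-integrable B (EFin \o pbar c Y psi tau).
Proof.
move=> cpsi; have [P psiP] := pbar_bounded tau cpsi.
apply: (@measurable_bounded_integrable _ _ _ mu) => //.
- exact: compact_rV_lebesgue_lty.
- by apply: within_continuous_measurable_rV => //; exact: pbar_continuous.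
- exists P; split; first exact: num_real.
  move=> M /ltW PM s Bs /=; apply: le_trans PM.
  by rewrite ger0_norm ?psiP// pbar_ge0.
Qed.

Lemma integrable_cst (k : R) : mu.-integrable B (EFin \o cst k).
Proof.
apply: (@measurable_bounded_integrable _ _ _ mu) => //.
- exact: compact_rV_lebesgue_lty.
- exact: bounded_cst.
Qed.

Definition mass psi tau : R := \int[mu]_(s in B) pbar c Y psi tau s.

Lemma mass_le_cst psi tau k : C_of Y psi ->
  (forall s, B s -> pbar c Y psi tau s <= k) -> mass psi tau <= k * fine (mu B).
Proof.
move=> cpsi psik; rewrite -(Rintegral_cst mu mB k).
by apply: le_Rintegral => //; [exact: integrable_pbar|exact: integrable_cst].
Qed.

Lemma mass_ge_cst psi tau k : C_of Y psi ->
  (forall s, B s -> k <= pbar c Y psi tau s) -> k * fine (mu B) <= mass psi tau.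
Proof.
move=> cpsi psik; rewrite -(Rintegral_cst mu mB k).
by apply: le_Rintegral => //; [exact: integrable_cst|exact: integrable_pbar].
Qed.

Lemma prob_densityP psi tau : C_of Y psi ->
  prob_density B (pbar c Y psi tau) <-> mass psi tau = 1.
Proof.
move=> cpsi.
have intE : (\int[mu]_(s in B) (pbar c Y psi tau s)%:E)%E =
    (mass psi tau)%:E.
  rewrite /mass /Rintegral fineK//.
  exact: integrable_fin_num (integrable_pbar tau cpsi).
split=> [[_ _]|mass1]; first by rewrite intE => -[].
split; last by rewrite intE mass1.
- by apply: within_continuous_measurable_rV => //; exact: pbar_continuous.
- by move=> s Bs; exact: pbar_ge0.
Qed.

Lemma pbar_nondecreasing psi tau tau' s : C_of Y psi -> B s -> tau <= tau' ->
  pbar c Y psi tau s <= pbar c Y psi tau' s.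
Proof.
move=> cpsi Bs tt'; apply/pbar_leP => //; first exact: pbar_ge0.
move=> y Yy.
have := (pbar_leP tau' Bs cpsi (pbar_ge0 tau' Bs cpsi)).1 (lexx _) y Yy.
by apply: le_trans; rewrite lerD2l.
Qed.

(** B has finite measure |B|, being compact: moving tau by less than 1 and
less than the growth constant for e / |B| moves pbar by at most e / |B| everywhere, and its integral
by at most e. *)
Lemma mass_continuous psi : C_of Y psi -> continuous (mass psi).
Proof.
move=> cpsi tau; apply/cvgrPdist_le => e e0.
(* A bound valid for all parameters up to tau + 1 serves for tau and for the
   nearby tau' at once. *)
have [P psiP] := pbar_bounded (tau + 1) cpsi.
have d0 : 0 < e / fine (mu B) by rewrite divr_gt0.
have [eta eta0 growth] := cost_uniform_growth P d0.
have near_tau : \forall tau' \near tau, `|tau - tau'| < Num.min eta 1.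
  apply: (@cvgr_dist_lt _ _ _ (nbhs tau) _ id tau) => //.
  by rewrite lt_min eta0 ltr01.
apply: filterS near_tau => tau'; rewrite lt_min !ltr_norml.
move=> /andP[/andP[t1 t2] /andP[t3 t4]].
have shift a b : a <= tau + 1 -> b < a + eta -> mass psi b <= mass psi a + e.
  move=> a1 ba; have -> : e = e / fine (mu B) * fine (mu B).
    by rewrite divfK// gt_eqF.
  rewrite -(Rintegral_cst mu mB) -RintegralD//;
    [|exact: integrable_pbar|exact: integrable_cst].
  apply: le_Rintegral => //.
  - exact: integrable_pbar.
  - by apply: eq_integrable (integrableD mB (integrable_pbar a cpsi)
      (integrable_cst (e / fine (mu B)))).
  - move=> s Bs; apply: (pbar_shift d0 growth) => //; first exact: psiP.
    by move=> p y p0 Yy; lra.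
have := shift tau tau'; have := shift tau' tau.
rewrite ler_norml => h1 h2.
have {}h1 : mass psi tau <= mass psi tau' + e by apply: h1; lra.
have {}h2 : mass psi tau' <= mass psi tau + e by apply: h2; lra.
by apply/andP; split; lra.
Qed.

Lemma mass_nondecreasing psi tau tau' : C_of Y psi -> tau <= tau' ->
  mass psi tau <= mass psi tau'.
Proof.
move=> cpsi tt'; apply: le_Rintegral => //; try exact: integrable_pbar.
by move=> s Bs; exact: pbar_nondecreasing.
Qed.

(** For tau the opposite of an upper bound of psi, psi + tau <= 0 <= c (s, 0), so
pbar vanishes. *)
Lemma mass_le0 psi : C_of Y psi -> exists tau, mass psi tau <= 0.
Proof.
move=> cpsi; have [M psiM] := compact_upper_bound Y_compact cpsi.
exists (- M); rewrite -(mul0r (fine (mu B))); apply: mass_le_cst => // s Bs.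
apply/pbar_leP => // y Yy; rewrite (le_trans _ (c_ge0 Bs (lexx 0) Yy))//.
by rewrite subr_le0 psiM.
Qed.

Lemma le_pbar psi tau s y P : C_of Y psi -> B s -> Y y -> 0 <= P ->
  c (s, P) y <= psi y + tau -> P <= pbar c Y psi tau s.
Proof.
move=> cpsi Bs Yy P0 cP; have p0 := pbar_ge0 tau Bs cpsi.
rewrite -(cost_leE Bs Yy P0 p0) (le_trans cP)//.
exact: (pbar_leP tau Bs cpsi p0).1 (lexx _) y Yy.
Qed.

(** The constant 1 / |B| has mass 1; a large tau makes a single y0 contribute at
least this value at every s. *)
Lemma mass_ge1 psi : C_of Y psi -> exists tau, 1 <= mass psi tau.
Proof.
move=> cpsi; have [y0 Yy0] := Y_neq0.
have P0 : 0 <= (fine (mu B))^-1 by rewrite invr_ge0 ltW.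
have [M cM] := cost_bounded P0.
exists (M - psi y0); rewrite -(mulVf (lt0r_neq0 muB_gt0)).
apply: mass_ge_cst => // s Bs; apply: (le_pbar cpsi Bs Yy0) => //.
by rewrite addrCA subrr addr0 cM.
Qed.

Lemma mass_eq1 psi : C_of Y psi -> exists tau, mass psi tau = 1.
Proof.
move=> cpsi; have [a a0] := mass_le0 cpsi; have [b b1] := mass_ge1 cpsi.
have ab : a <= b.
  rewrite leNgt; apply/negP => /ltW /(mass_nondecreasing cpsi).
  by move=> /(le_trans b1) /le_trans => /(_ _ a0); rewrite ler10.
have [||tau _] := @IVT R (mass psi) a b 1 ab; last by exists tau.
- by apply: continuous_subspaceT; exact: mass_continuous.
- by rewrite ge_min le_max (le_trans a0)// b1 orbT.
Qed.

(** Where pbar is positive, the maximizing y satisfies psi y + tau = c (s, p) y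
with p the value of pbar; a larger tau violates psi y + tau' <= c (s, p) y. *)
Lemma pbar_increasing psi tau tau' s : C_of Y psi -> B s -> tau < tau' ->
  0 < pbar c Y psi tau s -> pbar c Y psi tau s < pbar c Y psi tau' s.
Proof.
move=> cpsi Bs tt' p0; have [y Yy [yE _]] := pbar_eq tau Bs cpsi.
have [c0|c0] := leP (c (s, 0) y) (psi y + tau); last first.
  by move: p0; rewrite yE /q (lt_geF c0) ltxx.
have [p pp0 cp] := cost_surj Bs Yy c0.
rewrite yE -cp q_eq// ltNge; apply/negP => /(pbar_leP tau' Bs cpsi pp0).
by move=> /(_ y Yy); rewrite cp lerD2l leNgt tt'.
Qed.

(** If the two masses agree, the nonnegative difference of the functions vanishes
almost everywhere; by strict monotonicity pbar at tau then vanishes almost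
everywhere as well, so its mass is 0. The argument avoids continuity of pbar at
a point because B may carry pieces of measure zero. *)
Lemma mass_increasing psi tau tau' : C_of Y psi -> tau < tau' ->
  0 < mass psi tau -> mass psi tau < mass psi tau'.
Proof.
move=> cpsi tt' m0; rewrite lt_neqAle mass_nondecreasing ?ltW// andbT.
apply/eqP => mE; suff : mass psi tau = 0 by move=> m00; rewrite m00 ltxx in m0.
pose h s := pbar c Y psi tau' s - pbar c Y psi tau s.
have ih : mu.-integrable B (EFin \o h).
  by apply: eq_integrable (integrableB mB (integrable_pbar tau' cpsi)
    (integrable_pbar tau cpsi)).
have h_ge0 s : B s -> 0 <= h s.
  by move=> Bs; rewrite subr_ge0 pbar_nondecreasing// ltW.
have /(ae_eq_integral_abs _ mB (measurable_int _ ih)) h0 :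
    (\int[mu]_(s in B) `|(EFin \o h) s| = 0)%E.
  have -> : (\int[mu]_(s in B) `|(EFin \o h) s| = \int[mu]_(s in B) (h s)%:E)%E.
    by apply: eq_integral => s /set_mem Bs /=; rewrite ger0_norm// h_ge0.
  rewrite -[LHS]fineK ?(integrable_fin_num mB ih)//; congr EFin.
  by rewrite -/(Rintegral mu B h) RintegralB//; try exact: integrable_pbar;
    rewrite -/(mass psi tau) mE subrr.
rewrite /mass /Rintegral (ae_eq_integral (cst 0%E))//.
- by rewrite integral0.
- exact: measurable_int (integrable_pbar tau cpsi).
- apply: filterS h0 => s h0 Bs; have := h0 Bs; rewrite /h => -[] /eqP.
  rewrite subr_eq0 => /eqP pE; congr EFin; apply/eqP.
  rewrite eq_le pbar_ge0// andbT.
  by rewrite leNgt; apply/negP => /(pbar_increasing cpsi Bs tt'); rewrite pE ltxx.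
Qed.

Lemma unique_density psi : C_of Y psi ->
  exists! tau, prob_density B (pbar c Y psi tau).
Proof.
move=> cpsi; have [tau mass1] := mass_eq1 cpsi.
exists tau; split; first exact/prob_densityP.
move=> tau' /(prob_densityP tau' cpsi) mass1'.
by have [/(mass_increasing cpsi)|/(mass_increasing cpsi)|//] := ltgtP tau tau';
  rewrite mass1 mass1' ltr01 ltxx => /(_ isT).
Qed.

(** A density is at most 2 / |B| at some s0, since otherwise its mass would be at
least 2. This bounds psi + tau from above by a constant that depends on c alone,
and coercivity of c bounds pbar on all of B. *)
Lemma density_bounded : exists P, forall psi tau s,
  C_of Y psi -> mass psi tau = 1 -> B s -> pbar c Y psi tau s <= P.
Proof.
pose k := 2 / fine (mu B); have k0 : 0 <= k by rewrite divr_ge0// ltW.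
have [M cM] := cost_bounded k0; have [P P0 cP] := cost_coercive M.
exists P => psi tau s cpsi mass1 Bs.
have [s0 [Bs0 s0k]] : exists s0, B s0 /\ pbar c Y psi tau s0 <= k.
  apply: contrapT => large; suff : 2 <= mass psi tau by rewrite mass1 leNgt ltr1n.
  rewrite -[2](@divfK _ (fine (mu B))) ?lt0r_neq0//.
  apply: mass_ge_cst => // s1 Bs1; rewrite leNgt; apply/negP => /ltW s1k.
  by apply: large; exists s1.
apply/pbar_leP => // y Yy; rewrite (le_trans _ (cP s y Bs Yy))//.
rewrite (le_trans _ (cM s0 y Bs0 Yy))//.
exact: (pbar_leP tau Bs0 cpsi k0).1 s0k y Yy.
Qed.

(** The normalizing constant exists, so [tau_of] selects an actual density. *)
Lemma S_ofP f : S_of c B Y f ->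
  exists psi tau, [/\ C_of Y psi, mass psi tau = 1 & f = pbar c Y psi tau].
Proof.
move=> [psi cpsi <-]; exists psi, (tau_of c B Y psi); split => //.
apply/(prob_densityP _ cpsi); have [tau [tau1 _]] := unique_density cpsi.
apply: (getPex (P := [set tau | prob_density B (pbar c Y psi tau)])).
by exists tau.
Qed.

Lemma S_of_bounded : exists M : R, forall f, S_of c B Y f ->
  forall s, B s -> `|f s| <= M.
Proof.
have [P psiP] := density_bounded.
exists P => _ /S_ofP[psi [tau [cpsi mass1 ->]]] s Bs.
by rewrite ger0_norm ?pbar_ge0// psiP.
Qed.

Lemma S_of_equicontinuous : equicontinuous (S_of c B Y) id.
Proof.
have [P psiP] := density_bounded; move=> s E.
rewrite -entourage_ballE => -[e /= e0 eE].
apply: near_subspace => [Bs|_ f _]; last by apply: eE; exact: ballxx.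
have e20 : 0 < e / 2 by rewrite divr_gt0.
apply: filterS (pbar_modulus P e20 Bs) => s' close Bs'.
move=> _ /S_ofP[psi [tau [cpsi mass1 ->]]]; apply: eE => /=.
rewrite -ball_normE /=; apply: (le_lt_trans (close Bs' psi tau cpsi _)).
  by move=> s1; exact: psiP.
by rewrite ltr_pdivrMr// ltr_pMr// ltr1n.
Qed.

End cost.

Theorem proposition3p4 (R : realType) (d : nat) (hd : (2 <= d)%N)
  (B : set 'rV[R]_d.-1) (B_compact : compact B) (B_int : B° !=set0)
  (Y : set 'rV[R]_d) (Y_neq0 : Y !=set0) (Y_compact : compact Y)
  (c : 'rV[R]_d.-1 * R -> 'rV[R]_d -> R)
  (c_ge0 : forall s (p : R) y, B s -> 0 <= p -> Y y -> 0 <= c (s, p) y)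
  (c_lip : [locally [lipschitz (c z.1 z.2) |
              z in (B `*` `[0, +oo[) `*` Y]])
  (c_incr : forall s y, B s -> Y y ->
     {in `[0, +oo[ &, {homo (fun p => c (s, p) y) : p p' / p < p'}})
  (c_unbounded : forall s y, B s -> Y y ->
     ~ [bounded c (s, p) y | p in `[0, +oo[%classic])
  (c_equi : equicontinuous (`[0, +oo[ `*` Y)
     (fun (py : R * 'rV[R]_d) (s : subspace B) => c (s, py.1) py.2)) :
  [/\ (forall psi (tau : R) s, C_of Y psi -> B s ->
         exists2 y, Y y & forall y', Y y' ->
           q c s y' (psi y' + tau) <= q c s y (psi y + tau)),
      (forall psi, C_of Y psi ->
         exists! tau : R, prob_density B (pbar c Y psi tau)),
      (exists M : R, forall f, S_of c B Y f ->
         forall s, B s -> `|f s| <= M) &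
      equicontinuous (S_of c B Y) id].
Proof.
have c_cont := locally_lipschitz_within_continuous c_lip.
split.
- by move=> psi tau s cpsi Bs; apply: (q_max Y_neq0 Y_compact c_cont).
- by move=> psi cpsi; apply: unique_density.
- exact: S_of_bounded.
- exact: S_of_equicontinuous.
Qed.
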